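(* Let $A=(a_{ij})$ be a real symmetric $2\times 2$ matrix. The maximum value of $q(\vec{x})=\sum_{i,j=1}^{2}a_{ij}\,\vec{x}_i\cdot\vec{x}_j$ over all $\vec{x}_1,\vec{x}_2\in\mathbb{R}^2$ with $|\vec{x}_1|=|\vec{x}_2|=1$ is $a_{11}+a_{22}+2|a_{12}|$.
   Context: Here $\cdot$ is the standard inner product and $|\vec{x}_i|$ the Euclidean norm on $\mathbb{R}^2$. *)

(* Defs.v *)
From HB Require Import structures.
From mathcomp Require Import all_boot all_order all_algebra.
From mathcomp Require Import classical_sets reals.

Set Implicit Arguments.
Unset Strict Implicit.
Unset Printing Implicit Defensive.

Import Order.TTheory GRing.Theory Num.Theory.

Local Open Scope ring_scope.
Local Open Scope classical_set_scope.

Definition dot (R : realType) (d : nat) (u v : 'rV[R]_d) : R :=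
  \sum_(k < d) u 0 k * v 0 k.

(* The norm `|u| that the library puts on 'rV[R]_d is the sup norm, so the
   Euclidean norm is defined here. *)
Definition enorm (R : realType) (d : nat) (u : 'rV[R]_d) : R :=
  Num.sqrt (dot u u).

Definition qform (R : realType) (n d : nat) (A : 'M[R]_n)
    (x : 'I_n -> 'rV[R]_d) : R :=
  \sum_(i < n) \sum_(j < n) A i j * dot (x i) (x j).

(* Attained, unlike the library's [supremums]. *)
Definition is_maximum (R : realType) (S : set R) (m : R) : Prop :=
  S m /\ ubound S m.

(* Main.v *)
Require Import Defs.
From HB Require Import structures.
From mathcomp Require Import all_boot all_order all_algebra.
From mathcomp Require Import ring lra.
From mathcomp Require Import classical_sets reals.

Set Implicit Arguments.
Unset Strict Implicit.
Unset Printing Implicit Defensive.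

Import Order.TTheory GRing.Theory Num.Theory.

Local Open Scope ring_scope.
Local Open Scope classical_set_scope.

(** On unit vectors the diagonal terms add up to the trace, and symmetry merges the two off-diagonal
    terms, so only [2 * (A 0 1 * dot (x 0) (x 1))] varies ([qform2E]). The inner product lies in
    [-1, 1] ([normr_dot_le1]), which gives the upper bound; it is reached by two equal or opposite
    unit vectors, according to the sign of [A 0 1]. *)

Lemma dotC (R : realType) (d : nat) (u v : 'rV[R]_d) : dot u v = dot v u.
Proof. by apply: eq_bigr => k _; rewrite mulrC. Qed.

Lemma dotDl (R : realType) (d : nat) (u v w : 'rV[R]_d) :
  dot (u + v) w = dot u w + dot v w.
Proof. by rewrite -big_split; apply: eq_bigr => k _; rewrite mxE mulrDl. Qed.

Lemma dotZl (R : realType) (d : nat) (a : R) (u v : 'rV[R]_d) :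
  dot (a *: u) v = a * dot u v.
Proof. by rewrite /dot mulr_sumr; apply: eq_bigr => k _; rewrite mxE mulrA. Qed.

Lemma dot_ge0 (R : realType) (d : nat) (u : 'rV[R]_d) : 0 <= dot u u.
Proof. by apply: sumr_ge0 => k _; rewrite -expr2 sqr_ge0. Qed.

Lemma dot_delta (R : realType) (d : nat) (k : 'I_d) :
  dot (delta_mx 0 k : 'rV[R]_d) (delta_mx 0 k) = 1.
Proof.
rewrite /dot (bigD1 k) //= big1 ?addr0 ?mxE ?eqxx ?mulr1 // => i ik.
by rewrite !mxE (negPf ik) andbF mulr0.
Qed.

Lemma enorm_eq1 (R : realType) (d : nat) (u : 'rV[R]_d) :
  enorm u = 1 <-> dot u u = 1.
Proof.
rewrite /enorm; split=> [u1 | ->]; last exact: sqrtr1.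
by rewrite -(sqr_sqrtr (dot_ge0 u)) u1 expr1n.
Qed.

(** The boolean sign treats the expansions of |u + v|^2 and |u - v|^2 at once; the sign squares to 1
    in the term [dot v v]. *)
Lemma dot_signed_norm (R : realType) (d : nat) (b : bool) (u v : 'rV[R]_d) :
  dot (u + (-1) ^+ b *: v) (u + (-1) ^+ b *: v) =
  dot u u + dot v v + 2 * ((-1) ^+ b * dot u v).
Proof.
rewrite dotDl dotZl ![dot _ (_ + _)]dotC !dotDl !dotZl (dotC v u) mulrDr.
by rewrite mulrA -signr_addb addbb mul1r; ring.
Qed.

(** Cauchy-Schwarz for unit vectors: 0 <= |u + v|^2 = 2 + 2 u.v and 0 <= |u - v|^2 = 2 - 2 u.v bound
    u.v on both sides. *)
Lemma normr_dot_le1 (R : realType) (d : nat) (u v : 'rV[R]_d) :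
  enorm u = 1 -> enorm v = 1 -> `|dot u v| <= 1.
Proof.
move=> /enorm_eq1 u1 /enorm_eq1 v1.
have pos := dot_ge0 (u + (-1) ^+ false *: v).
have neg := dot_ge0 (u + (-1) ^+ true *: v).
move: pos neg; rewrite !dot_signed_norm u1 v1 expr0 expr1 => pos neg.
by rewrite ler_norml; lra.
Qed.

Lemma qform2E (R : realType) (d : nat) (A : 'M[R]_2) (x : 'I_2 -> 'rV[R]_d) :
  A \is symmetricmx -> (forall i, enorm (x i) = 1) ->
  qform A x = A 0 0 + A 1 1 + 2 * (A 0 1 * dot (x 0) (x 1)).
Proof.
move=> /is_hermitianmxP hA x1.
have A10 : A 1 0 = A 0 1 by rewrite {1}hA !mxE expr0 mul1r.
have dot1 i : dot (x i) (x i) = 1 by apply/enorm_eq1.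
have l01 : lift ord0 ord0 = 1 :> 'I_2 by apply: val_inj.
rewrite /qform !big_ord_recl !big_ord0 !l01 !dot1 A10 (dotC (x 1)).
by ring.
Qed.

Theorem mainTheorem3 (R : realType) (A : 'M[R]_2) (hA : A \is symmetricmx) :
  is_maximum
    [set qform A x | x in [set x : 'I_2 -> 'rV[R]_2 | forall i, enorm (x i) = 1]]
    (A 0 0 + A 1 1 + 2 * `|A 0 1|).
Proof.
split=> [|_ [x /= x1 <-]].
  pose e : 'rV[R]_2 := delta_mx 0 0.
  (* Only the vector of index 1 is ever flipped, and exactly when [A 0 1] is negative, so that
     [A 0 1 * dot (x 0) (x 1)] becomes the absolute value of [A 0 1]. *)
  pose s (i : 'I_2) := (i == 1) && (A 0 1 < 0).
  have dotse (b c : bool) : dot ((-1) ^+ b *: e) ((-1) ^+ c *: e) = (-1) ^+ (b (+) c).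
    by rewrite dotZl dotC dotZl dot_delta mulr1 signr_addb.
  have x1 i : enorm ((-1) ^+ s i *: e) = 1.
    by apply/enorm_eq1; rewrite dotse addbb.
  exists (fun i => (-1) ^+ s i *: e) => //.
  by rewrite qform2E // dotse [`|_|]normrEsign [A 0 1 * _]mulrC.
rewrite qform2E // lerD2l ler_pM2l ?ltr0n //.
(* Passing to the absolute value of the product covers both signs of [A 0 1]. *)
apply: (le_trans (ler_norm _)); rewrite normrM ler_piMr //.
exact: normr_dot_le1.
Qed.
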